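(* Let $(S,\lhd)$ be a self-similar structure of a semi-monoidal category $(\mathcal C,\otimes)$, and let $\mathcal X\mathrm{Sub}:(\mathcal X,\Box)\to(\mathcal C,\otimes)$ be the associated self-similarity substitution functor. Then every diagram over $\mathcal C$ of the form $\mathcal X\mathrm{Sub}(\mathfrak D)$, for some diagram $\mathfrak D$ over $\mathcal X$, commutes.
   Context: A semi-monoidal category is a category $\mathcal C$ with a functor $\otimes:\mathcal C\times\mathcal C\to\mathcal C$ and natural isomorphisms $\tau_{X,Y,Z}:X\otimes(Y\otimes Z)\to(X\otimes Y)\otimes Z$ satisfying MacLane's pentagon condition; no unit object is assumed. Standing convention: every object $A$ of a semi-monoidal category is faithful, i.e. the functors $A\otimes\_$ and $\_\otimes A$ are faithful. A self-similar structure $(S,\lhd)$ of $\mathcal C$ consists of an object $S$ and an isomorphism $\lhd:S\otimes S\to S$, with inverse $\rhd=\lhd^{-1}:S\to S\otimes S$. $\mathrm{Tree}$ is the set of non-empty binary trees over a symbol $x$: $x\in\mathrm{Tree}$, and $(u\Box v)\in\mathrm{Tree}$ for all $u,v\in\mathrm{Tree}$. The category $\mathcal X$ has $Ob(\mathcal X)=\mathrm{Tree}$ and exactly one arrow $(b\leftarrow a)\in\mathcal X(a,b)$ for all $a,b\in\mathrm{Tree}$; its tensor is $u\Box v$ on objects and is determined on arrows by uniqueness. The functor $\mathcal X\mathrm{Sub}$ is defined inductively by: $\mathcal X\mathrm{Sub}(x)=S$, $\mathcal X\mathrm{Sub}(u\Box v)=\mathcal X\mathrm{Sub}(u)\otimes\mathcal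 X\mathrm{Sub}(v)$ on objects, and on arrows $\mathcal X\mathrm{Sub}(x\leftarrow x)=1_S$, $\mathcal X\mathrm{Sub}(x\leftarrow u\Box v)=\lhd\,(\mathcal X\mathrm{Sub}(x\leftarrow u)\otimes\mathcal X\mathrm{Sub}(x\leftarrow v))$, $\mathcal X\mathrm{Sub}(u\Box v\leftarrow x)=(\mathcal X\mathrm{Sub}(u\leftarrow x)\otimes\mathcal X\mathrm{Sub}(v\leftarrow x))\,\rhd$, and $\mathcal X\mathrm{Sub}(u\Box v\leftarrow p\Box q)=\mathcal X\mathrm{Sub}(u\Box v\leftarrow x)\,\mathcal X\mathrm{Sub}(x\leftarrow p\Box q)$. Composition is written right to left. *)

(* Defs.v *)
Set Implicit Arguments.
Unset Strict Implicit.
Unset Printing Implicit Defensive.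

Record category : Type := Category {
  ob :> Type;
  hom : ob -> ob -> Type;
  idm : forall a, hom a a;
  comp : forall a b c, hom b c -> hom a b -> hom a c;
  comp_idl : forall a b (f : hom a b), comp (idm b) f = f;
  comp_idr : forall a b (f : hom a b), comp f (idm a) = f;
  comp_assoc : forall a b c d (h : hom c d) (g : hom b c) (f : hom a b),
    comp h (comp g f) = comp (comp h g) f
}.

Declare Scope cat_scope.
Delimit Scope cat_scope with cat.
Local Open Scope cat_scope.

(* Composition is written right to left: [g ∘ f] is "f, then g". *)
Notation "g ∘ f" := (comp g f) (at level 40, left associativity) : cat_scope.

Record functor (C D : category) : Type := Functor {
  fob :> C -> D;
  fmap : forall a b : C, hom a b -> hom (fob a) (fob b);
  fmap_id : forall a, fmap (idm a) = idm (fob a);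
  fmap_comp : forall a b c (g : hom b c) (f : hom a b),
    fmap (g ∘ f) = fmap g ∘ fmap f
}.

(* There is no unit object.  The last two fields are the convention that every
   object [a] is faithful, i.e. that the functors [a ⊗ _] and [_ ⊗ a] are. *)
Record semimonoidal : Type := SemiMonoidal {
  smcat :> category;
  tob : smcat -> smcat -> smcat;
  tmap : forall a a' b b' : smcat,
    hom a a' -> hom b b' -> hom (tob a b) (tob a' b');
  tmap_id : forall a b, tmap (idm a) (idm b) = idm (tob a b);
  tmap_comp : forall a a' a'' b b' b''
    (g : hom a' a'') (f : hom a a') (k : hom b' b'') (h : hom b b'),
    tmap (g ∘ f) (k ∘ h) = tmap g k ∘ tmap f h;
  tau : forall a b c, hom (tob a (tob b c)) (tob (tob a b) c);
  tau_inv : forall a b c, hom (tob (tob a b) c) (tob a (tob b c));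
  tauK : forall a b c, tau_inv a b c ∘ tau a b c = idm (tob a (tob b c));
  tau_invK : forall a b c, tau a b c ∘ tau_inv a b c = idm (tob (tob a b) c);
  tau_natural : forall a a' b b' c c'
    (f : hom a a') (g : hom b b') (h : hom c c'),
    tau a' b' c' ∘ tmap f (tmap g h) = tmap (tmap f g) h ∘ tau a b c;
  pentagon : forall a b c d,
    tau (tob a b) c d ∘ tau a b (tob c d) =
    tmap (tau a b c) (idm d) ∘ tau a (tob b c) d ∘ tmap (idm a) (tau b c d);
  faithful_l : forall a b c (f g : hom b c),
    tmap (idm a) f = tmap (idm a) g -> f = g;
  faithful_r : forall a b c (f g : hom b c),
    tmap f (idm a) = tmap g (idm a) -> f = g
}.

Notation "a ⊗ b" := (tob a b) (at level 35, right associativity) : cat_scope.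
Notation "f ⊠ g" := (tmap f g) (at level 35, right associativity) : cat_scope.

Record self_similar (C : semimonoidal) : Type := SelfSimilar {
  ssob : C;
  code : hom (ssob ⊗ ssob) ssob;      (* ◁ *)
  decode : hom ssob (ssob ⊗ ssob);    (* ▷, the inverse of ◁ *)
  codeK : decode ∘ code = idm (ssob ⊗ ssob);
  decodeK : code ∘ decode = idm ssob
}.

(* A diagram is a directed multigraph, possibly infinite, with nodes labelled
   by objects and edges by arrows.  Distinct nodes may carry the same label. *)
Record diagram (C : category) : Type := Diagram {
  node : Type;
  edge : node -> node -> Type;
  node_ob : node -> C;
  edge_hom : forall i j, edge i j -> hom (node_ob i) (node_ob j)
}.

Inductive path (V : Type) (E : V -> V -> Type) (i : V) : V -> Type :=
| path_nil : path E i i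
| path_snoc : forall j k, path E i j -> E j k -> path E i k.

Fixpoint path_hom (C : category) (D : diagram C) (i j : node D)
    (p : path (@edge C D) i j) : hom (node_ob i) (node_ob j) :=
  match p with
  | path_nil _ _ => idm (node_ob i)
  | path_snoc q e => edge_hom e ∘ path_hom q
  end.

(* Empty paths are allowed, so a closed path must compose to an identity. *)
Definition commutes (C : category) (D : diagram C) : Prop :=
  forall (i j : node D) (p q : path (@edge C D) i j), path_hom p = path_hom q.

(* The image of a diagram keeps its underlying graph. *)
Definition map_diagram (C C' : category) (F : functor C C') (D : diagram C) :
    diagram C' :=
  {| node := node D;
     edge := @edge C D;
     node_ob := fun i => F (node_ob i);
     edge_hom := fun i j e => fmap F (edge_hom e) |}.

Inductive tree : Set :=
| leaf : tree
| box : tree -> tree -> tree.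

Lemma unit_irrelevance (s t : unit) : s = t.
Proof. now destruct s, t. Qed.

Definition tree_category : category :=
  @Category tree (fun _ _ => unit) (fun _ => tt) (fun _ _ _ _ _ => tt)
    (fun _ _ _ => unit_irrelevance _ _) (fun _ _ _ => unit_irrelevance _ _)
    (fun _ _ _ _ _ _ _ => unit_irrelevance _ _).

Definition treeX : semimonoidal.
Proof.
refine (@SemiMonoidal tree_category box (fun _ _ _ _ _ _ => tt) _ _
          (fun _ _ _ => tt) (fun _ _ _ => tt) _ _ _ _ _ _);
  intros; apply unit_irrelevance.
Defined.

Section Substitution.
Variables (C : semimonoidal) (S : self_similar C).

Fixpoint xsub_ob (t : tree) : C :=
  match t with
  | leaf => ssob S
  | box u v => xsub_ob u ⊗ xsub_ob v
  end.

(* The arrow assigned to [x ← t]. *)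
Fixpoint xsub_in (t : tree) : hom (xsub_ob t) (ssob S) :=
  match t with
  | leaf => idm (ssob S)
  | box u v => code S ∘ (xsub_in u ⊠ xsub_in v)
  end.

(* The arrow assigned to [t ← x]. *)
Fixpoint xsub_out (t : tree) : hom (ssob S) (xsub_ob t) :=
  match t with
  | leaf => idm (ssob S)
  | box u v => (xsub_out u ⊠ xsub_out v) ∘ decode S
  end.

(* The arrow assigned to [b ← a]. *)
Definition xsub_arrow (a b : tree) : hom (xsub_ob a) (xsub_ob b) :=
  match b, a with
  | leaf, leaf => idm (ssob S)
  | leaf, box p q => xsub_in (box p q)
  | box u v, leaf => xsub_out (box u v)
  | box u v, box p q => xsub_out (box u v) ∘ xsub_in (box p q)
  end.

Lemma xsub_arrow_in t : xsub_arrow t leaf = xsub_in t.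
Proof. now destruct t. Qed.

Lemma xsub_arrow_out t : xsub_arrow leaf t = xsub_out t.
Proof. now destruct t. Qed.

(* [xsub_arrow] satisfies the inductive clauses that define the functor. *)
Lemma xsub_arrow_leaf_leaf : xsub_arrow leaf leaf = idm (ssob S).
Proof. reflexivity. Qed.

Lemma xsub_arrow_leaf_box u v :
  xsub_arrow (box u v) leaf = code S ∘ (xsub_arrow u leaf ⊠ xsub_arrow v leaf).
Proof. now rewrite !xsub_arrow_in. Qed.

Lemma xsub_arrow_box_leaf u v :
  xsub_arrow leaf (box u v) = (xsub_arrow leaf u ⊠ xsub_arrow leaf v) ∘ decode S.
Proof. now rewrite !xsub_arrow_out. Qed.

Lemma xsub_arrow_box_box p q u v :
  xsub_arrow (box p q) (box u v) =
  xsub_arrow leaf (box u v) ∘ xsub_arrow (box p q) leaf.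
Proof. reflexivity. Qed.

Lemma xsub_arrowE a b : xsub_arrow a b = xsub_out b ∘ xsub_in a.
Proof.
destruct a, b; cbn [xsub_arrow xsub_in xsub_out];
  now rewrite ?comp_idl, ?comp_idr.
Qed.

Lemma xsub_inK t : xsub_out t ∘ xsub_in t = idm (xsub_ob t).
Proof.
induction t as [|u IHu v IHv]; simpl; [apply comp_idl|].
rewrite <- comp_assoc, (comp_assoc (decode S)), codeK, comp_idl.
now rewrite <- tmap_comp, IHu, IHv, tmap_id.
Qed.

Lemma xsub_outK t : xsub_in t ∘ xsub_out t = idm (ssob S).
Proof.
induction t as [|u IHu v IHv]; simpl; [apply comp_idl|].
rewrite <- comp_assoc, (comp_assoc (xsub_in u ⊠ xsub_in v)), <- tmap_comp.
now rewrite IHu, IHv, tmap_id, comp_idl, decodeK.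
Qed.

Lemma xsub_arrow_id a : xsub_arrow a a = idm (xsub_ob a).
Proof. now rewrite xsub_arrowE, xsub_inK. Qed.

Lemma xsub_arrow_comp a b c :
  xsub_arrow a c = xsub_arrow b c ∘ xsub_arrow a b.
Proof.
rewrite !xsub_arrowE, <- comp_assoc, (comp_assoc (xsub_in b)).
now rewrite xsub_outK, comp_idl.
Qed.

Definition XSub : functor treeX C :=
  @Functor treeX C xsub_ob (fun a b _ => xsub_arrow a b) xsub_arrow_id
    (fun a b c _ _ => xsub_arrow_comp a b c).

(* [XSub] strictly preserves the tensor; on objects this holds by definition.
   It need not preserve the associator. *)
Lemma XSub_tensor (a a' b b' : treeX) (f : hom a a') (g : hom b b') :
  fmap XSub (f ⊠ g) = fmap XSub f ⊠ fmap XSub g.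
Proof.
change (xsub_arrow (box a b) (box a' b') = xsub_arrow a a' ⊠ xsub_arrow b b').
rewrite !xsub_arrowE; simpl.
rewrite <- comp_assoc, (comp_assoc (decode S)), codeK, comp_idl.
now rewrite <- tmap_comp.
Qed.

End Substitution.

(* Main.v *)
Require Import Defs.

(** Any two parallel arrows of the tree category are equal, so every diagram
    over it commutes.  A functor sends the composite along a path to the
    composite along the image path ([path_hom_map]), hence it sends commuting
    diagrams to commuting diagrams ([commutes_map]).  All the content specific
    to self-similarity is thus in the functoriality of [XSub], which comes from
    [xsub_out] and [xsub_in] being mutually inverse: each [xsub_arrow a b]
    factors through [ssob S], and composites telescope. *)

Lemma path_hom_map (C C' : category) (F : functor C C') (D : diagram C)
    (i j : node D) (p : path (@edge C D) i j) :
  @path_hom C' (map_diagram F D) i j p = fmap F (path_hom p).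
Proof.
induction p as [|j k p IHp e]; simpl.
- symmetry; apply fmap_id.
- now rewrite fmap_comp, <- IHp.
Qed.

Lemma commutes_map (C C' : category) (F : functor C C') (D : diagram C) :
  commutes D -> commutes (map_diagram F D).
Proof.
intros HD i j p q.
transitivity (fmap F (@path_hom C D i j p)); [apply path_hom_map|].
rewrite (HD i j p q).
symmetry; apply path_hom_map.
Qed.

Lemma commutes_thin (C : category) (D : diagram C) :
  (forall (a b : C) (f g : hom a b), f = g) -> commutes D.
Proof. intros thin i j p q; apply thin. Qed.

Theorem lemma6p10 (C : semimonoidal) (S : self_similar C) (D : diagram treeX) :
  commutes (map_diagram (XSub S) D).
Proof.
apply commutes_map, commutes_thin.
intros a b; apply unit_irrelevance.
Qed.
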